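(* Let $f\in\mathcal{F}_1$, i.e. $f\in\mathcal{S}$ and $\operatorname{Re}\{(1-z)f'(z)\}>0$ for all $z\in\mathbb{D}$. Then the third logarithmic coefficient $\gamma_3$ of $f$ satisfies $$|\gamma_3|\leq \frac{15.75}{48}=0.328125.$$
   Context: $\mathbb{D}=\{z\in\mathbb{C}:|z|<1\}$ is the open unit disk. $\mathcal{A}$ is the set of all analytic functions $f$ in $\mathbb{D}$ of the form $f(z)=\sum_{n=1}^{\infty}a_nz^n$ with $a_1=1$ (that is, $f(0)=0$, $f'(0)=1$), and $\mathcal{S}\subset\mathcal{A}$ is the subclass of functions univalent (injective) in $\mathbb{D}$. $\mathcal{F}_1$ is the class of $f\in\mathcal{S}$ with $\operatorname{Re}\{(1-z)f'(z)\}>0$ for all $z\in\mathbb{D}$. For $f\in\mathcal{S}$, the logarithmic coefficients $\gamma_n$ ($n\ge 1$) of $f$ are the complex numbers defined by $\log\frac{f(z)}{z}=2\sum_{n=1}^{\infty}\gamma_nz^n$, $z\in\mathbb{D}\setminus\{0\}$, where the branch of the logarithm is the one with $\log 1=0$ (i.e. the analytic branch of $\log(f(z)/z)$ on $\mathbb{D}$ vanishing at $z=0$, where $f(z)/z$ is given the value $1$ at $0$). The coefficients $a_n$ may be complex. *)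

(* Defs.v *)
From Stdlib Require Export Reals.
From Coquelicot Require Export Coquelicot.
Open Scope R_scope.

Definition disk (z : C) : Prop := Cmod z < 1.

Definition holomorphic_on_disk (g : C -> C) : Prop :=
  forall z : C, disk z ->
    ex_derive (K := C_AbsRing) (V := C_NormedModule) g z.

(** [g z = sum_(n >= 1) c n * z ^ n] on the whole disk; [c 0] plays no role. *)
Definition expands_from_1 (c : nat -> C) (g : C -> C) : Prop :=
  forall z : C, disk z ->
    is_pseries (K := C_AbsRing) (V := C_NormedModule)
      (fun n => match n with O => RtoC 0 | S _ => c n end) z (g z).

Definition class_A (f : C -> C) : Prop :=
  holomorphic_on_disk f /\
  exists a : nat -> C, a 1%nat = RtoC 1 /\ expands_from_1 a f.

Definition class_S (f : C -> C) : Prop :=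
  class_A f /\
  forall z w : C, disk z -> disk w -> f z = f w -> z = w.

(** [C_derive] takes the limit of the difference quotient along the horizontal
    direction only; [f] being holomorphic on the disk, it is the complex
    derivative of [f] there ([C_derive_correct]). *)
Definition class_F1 (f : C -> C) : Prop :=
  class_S f /\
  forall z : C, disk z -> 0 < Re ((1 - z) * C_derive f z)%C.

(** The complex exponential, which Coquelicot does not provide. *)
Definition Cexp (z : C) : C :=
  (exp (Re z) * cos (Im z), exp (Re z) * sin (Im z)).

(** [L] is the holomorphic branch of [log (f z / z)] on the disk, where
    [f z / z] is read as [1] at [z = 0], so that the branch with [log 1 = 0]
    is the one with [L 0 = 0]. *)
Definition is_log_branch (f L : C -> C) : Prop :=
  holomorphic_on_disk L /\
  L (RtoC 0) = RtoC 0 /\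
  forall z : C, disk z -> z <> RtoC 0 -> Cexp (L z) = (f z / z)%C.

(** For [f] in [class_S] the branch [L] exists and is unique on the disk, so
    this relation determines [gamma n] for all [n >= 1]; [gamma 0] is unused. *)
Definition log_coefficients (f : C -> C) (gamma : nat -> C) : Prop :=
  exists L : C -> C,
    is_log_branch f L /\
    expands_from_1 (fun n => 2 * gamma n)%C L.

(* Main.v *)
(** Let [p = (1 - z) f' = 1 + 2 d1 z + 2 d2 z^2 + 2 d3 z^3 + ...], which has
    positive real part. Averaging [Re p(r u) |q(u)|^2] over [N]-th roots of unity
    [u], for polynomials [q] of degree 3, with [N] larger than the degree of a
    truncation of [p], and letting [r -> 1], shows that the 4x4 Toeplitz form of
    [1, 2 d1, 2 d2, 2 d3] is nonnegative. Testing this form on the Szego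
    predictors gives [d1 = t], [d2 = t^2 + s x] and
    [d3 = t^3 + 2 t s x - conj t s x^2 + y], where [s = 1 - |t|^2], [|x| <= 1] and
    [|y| <= s (1 - |x|^2)]. In these parameters
    [48 gamma_3 = 3 + 2 t + 4 t^3 + 4 s x (1 + 2 t) - 12 s conj t x^2 + 12 y],
    and the triangle inequality leaves a function of [|t|] and [|x|] whose maximum,
    attained at [|t| = 1/4], is 15.75. *)
Require Import Defs.
From Stdlib Require Import Lra Lia.

(** * Toeplitz forms and Schur parameters *)

(** The mean over the unit circle of [p |q|^2] for [p = c0 + c1 u + c2 u^2 + c3 u^3] and
    [q = q0 + q1 u + q2 u^2 + q3 u^3]: [c_k] meets the products [q_i conj q_(i+k)]. *)
Definition toeplitz4 (c0 c1 c2 c3 q0 q1 q2 q3 : C) : C :=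
  (c0 * (q0 * Cconj q0 + q1 * Cconj q1 + q2 * Cconj q2 + q3 * Cconj q3)
   + c1 * (q0 * Cconj q1 + q1 * Cconj q2 + q2 * Cconj q3)
   + c2 * (q0 * Cconj q2 + q1 * Cconj q3) + c3 * (q0 * Cconj q3))%C.

Lemma Cmod_sq (z : C) : Cmod z * Cmod z = Re z * Re z + Im z * Im z.
Proof.
  unfold Cmod. rewrite sqrt_sqrt.
  - unfold Re, Im; ring.
  - nra.
Qed.

(** The rotation [l = - conj w / |w|] turns [l w] into [- |w|]; for [w = 0], [l = 1] gives
    [0 <= A]. *)
Lemma Cmod_le_of_rotations (A : R) (w : C) :
  (forall l : C, Cmod l = 1 -> 0 <= A + Re (l * w)%C) -> Cmod w <= A.
Proof.
  intros H. destruct (Req_dec (Cmod w) 0) as [E|E].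
  - rewrite E. specialize (H 1). rewrite Cmod_1 in H. specialize (H eq_refl).
    apply Cmod_eq_0 in E. rewrite E in H. simpl in H. lra.
  - assert (P := Cmod_ge_0 w).
    assert (E' : RtoC (Cmod w) <> 0) by (intros K; apply E, RtoC_inj; exact K).
    specialize (H (- Cconj w / Cmod w)%C).
    rewrite Cmod_div, Cmod_opp, Cmod_conj, Cmod_R, Rabs_pos_eq in H by auto.
    replace (- Cconj w / Cmod w * w)%C with (RtoC (- Cmod w)) in H.
    + simpl in H. assert (0 <= A + - Cmod w) by (apply H; field; auto). lra.
    + replace (- Cconj w / Cmod w * w)%C with (- (w * Cconj w) / Cmod w)%C by (field; auto).
      rewrite <- Cmod2_conj, RtoC_opp, RtoC_pow. field; auto.
Qed.

(** For [|l| = 1] the form at [l] times a predictor plus its reversed conjugate is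
    [2 (D + Re (l w))]. Here [D] is the prediction error, in turn [1], [s] and [s (1 - |x|^2)], and
    [w] is the deviation of the next coefficient from its predicted value. Rotating [l] gives
    [|w| <= D]. *)
Lemma toeplitz4_schur (d1 d2 d3 : C) :
  (forall q0 q1 q2 q3 : C,
    0 <= Re (toeplitz4 1 (2 * d1) (2 * d2) (2 * d3) q0 q1 q2 q3)) ->
  exists x y : C,
    let s := 1 - Cmod d1 * Cmod d1 in
    Cmod d1 <= 1 /\ Cmod x <= 1 /\
    Cmod y <= s * (1 - Cmod x * Cmod x) /\
    d2 = (d1 * d1 + s * x)%C /\
    d3 = (d1 * d1 * d1 + 2 * d1 * (s * x) - Cconj d1 * (s * x) * x + y)%C.
Proof.
  intros H.
  assert (H1 : Cmod d1 <= 1).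
  { apply Cmod_le_of_rotations. intros l Hl.
    specialize (H l 1 0 0).
    assert (Q := Cmod_sq l). rewrite Hl in Q.
    unfold toeplitz4 in H. destruct l as [a b], d1 as [t1 t2], d2, d3. simpl in *. nra. }
  assert (H2 : Cmod (d2 - d1 * d1) <= 1 - Cmod d1 * Cmod d1).
  { apply Cmod_le_of_rotations. intros l Hl.
    (* [l] times the order-1 predictor [(1, - d1, 0, 0)] plus its reversed conjugate
       [(0, - conj d1, 1, 0)]. *)
    specialize (H l (- d1 * l - Cconj d1)%C 1 0)%C.
    assert (Q := Cmod_sq l). rewrite Hl in Q. rewrite (Cmod_sq d1).
    (* Keeping [1 + |l|^2] as a factor makes this a polynomial identity in the components; [|l| = 1]
       enters afterwards. *)
    replace (Re _) with ((1 + (Re l * Re l + Im l * Im l)) * (1 - (Re d1 * Re d1 + Im d1 * Im d1))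
       + 2 * Re (l * (d2 - d1 * d1))%C) in H.
    - rewrite <- Q in H. lra.
    - unfold toeplitz4. destruct l as [a b], d1 as [t1 t2], d2, d3. simpl. ring. }
  set (s := 1 - Cmod d1 * Cmod d1) in *.
  assert (Hx : exists x : C, Cmod x <= 1 /\ (d2 - d1 * d1)%C = (s * x)%C).
  { destruct (Req_dec s 0) as [E|E].
    (* If [s = 0], then [d2 = d1^2] and any [x] in the closed disk would serve. *)
    - exists 0. rewrite Cmod_0. split; [lra|]. rewrite Cmult_0_r.
      apply Cmod_eq_0. assert (G := Cmod_ge_0 (d2 - d1 * d1)). lra.
    - assert (0 < s) by (assert (G := Cmod_ge_0 (d2 - d1 * d1)); lra).
      assert (RtoC s <> 0) by (intros K; apply E; apply RtoC_inj; exact K).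
      exists ((d2 - d1 * d1) / s)%C. split; [|field; auto].
      rewrite Cmod_div; auto. rewrite Cmod_R, Rabs_pos_eq; [|lra].
      apply (Rmult_le_reg_r s); auto. field_simplify; lra. }
  destruct Hx as [x [Hx1 Hx2]].
  exists x, (d3 - (d1 * d1 * d1 + 2 * d1 * (s * x) - Cconj d1 * (s * x) * x))%C.
  simpl. repeat split; auto.
  2: rewrite <- Hx2; ring.
  2: ring.
  apply Cmod_le_of_rotations. intros l Hl.
  assert (Q := Cmod_sq l). rewrite Hl in Q. rewrite (Cmod_sq x).
  assert (E2 : d2 = (d1 * d1 + s * x)%C) by (rewrite <- Hx2; ring).
  (* [l] times the order-2 predictor [(1, x conj d1 - d1, - x, 0)] plus its reversed conjugate. *)
  specialize (H l (- (d1 - x * Cconj d1) * l - Cconj x)%C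
     (- x * l - Cconj (d1 - x * Cconj d1))%C 1).
  unfold s in *. clear s. rewrite (Cmod_sq d1) in *.
  rewrite E2 in H. clear E2 Hx2 H2 H1.
  replace (Re _) with ((1 + (Re l * Re l + Im l * Im l)) * ((1 - (Re d1 * Re d1 + Im d1 * Im d1))
      * (1 - (Re x * Re x + Im x * Im x)))
       + 2 * Re (l * (d3 - (d1 * d1 * d1 + 2 * d1 * ((1 - (Re d1 * Re d1 + Im d1 * Im d1))%R * x)
         - Cconj d1 * ((1 - (Re d1 * Re d1 + Im d1 * Im d1))%R * x) * x)))%C) in H.
  - rewrite <- Q in H. lra.
  - unfold toeplitz4. destruct l as [a b], d1 as [t1 t2], x as [x1 x2], d3. simpl. ring.
Qed.

(** * Sharp estimate of the functional in the Schur parameters *)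

Lemma logarithmic_functional_bound (t x y : C) :
  Cmod t <= 1 -> Cmod x <= 1 ->
  Cmod y <= (1 - Cmod t * Cmod t) * (1 - Cmod x * Cmod x) ->
  Cmod (3 + 2 * t + 4 * (t * t * t)
        + 4 * ((1 - Cmod t * Cmod t)%R * (x * (1 + 2 * t)))
        - 12 * ((1 - Cmod t * Cmod t)%R * (Cconj t * (x * x))) + 12 * y)%C <= 15.75.
Proof.
  intros Ht Hx Hy.
  assert (T0 := Cmod_ge_0 t). assert (X0 := Cmod_ge_0 x).
  assert (Hc : forall r : R, 0 <= r -> Cmod r = r).
  { intros r Hr. rewrite Cmod_R. apply Rabs_pos_eq; auto. }
  assert (Hs : 0 <= 1 - Cmod t * Cmod t) by nra.
  eapply Rle_trans; [apply Cmod_triangle|].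
  rewrite Cmod_mult, Hc by lra.
  eapply Rle_trans.
  { apply Rplus_le_compat_r. unfold Cminus. apply Cmod_triangle. }
  rewrite Cmod_opp, !Cmod_mult, Cmod_conj, (Hc 12), (Hc (1 - _)) by lra.
  eapply Rle_trans.
  { apply Rplus_le_compat_r, Rplus_le_compat_r. apply Cmod_triangle. }
  rewrite !Cmod_mult, (Hc 4), (Hc (1 - _)) by lra.
  assert (A : Cmod (1 + 2 * t) <= 1 + 2 * Cmod t).
  { eapply Rle_trans; [apply Cmod_triangle|]. rewrite Cmod_mult, !Hc; lra. }
  assert (B : Cmod (3 + 2 * t + 4 * (t * t * t)) <= 3 + 2 * Cmod t + 4 * (Cmod t * Cmod t * Cmod t)).
  { eapply Rle_trans; [apply Cmod_triangle|]. rewrite !Cmod_mult, (Hc 4) by lra.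
    apply Rplus_le_compat_r. eapply Rle_trans; [apply Cmod_triangle|].
    rewrite Cmod_mult, !Hc; lra. }
  set (v := Cmod (1 + 2 * t)) in *. set (w := Cmod (3 + _ + _)) in *.
  set (tau := Cmod t) in *. set (rho := Cmod x) in *.
  assert (V : (1 - tau * tau) * (rho * v) <= (1 - tau * tau) * (rho * (1 + 2 * tau))).
  { apply Rmult_le_compat_l; auto. apply Rmult_le_compat_l; auto. }
  (* Maximising the quadratic in [rho] leaves [(tau - 1/4)^2 (20 - 16 tau) / 3 >= 0]. *)
  assert (S1 : 0 <= (1 + tau) * (1 + 2 * tau - 6 * (1 - tau) * rho) ^ 2).
  { apply Rmult_le_pos; [lra|apply pow2_ge_0]. }
  assert (S2 : 0 <= (tau - 1/4) ^ 2 * (20 - 16 * tau)).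
  { apply Rmult_le_pos; [apply pow2_ge_0|lra]. }
  (* The majorant in [tau] and [rho] equals [15.75] minus a third of the sum of the two nonnegative
     products. *)
  nra.
Qed.

(** * Complex power series on the disk *)

Notation is_seriesC := (@is_series C_AbsRing C_NormedModule).
Notation is_pseriesC := (@is_pseries C_AbsRing C_NormedModule).

Lemma pow_n_Cpow (z : C) (n : nat) : pow_n (K := C_AbsRing) z n = (z ^ n)%C.
Proof. induction n; [reflexivity|]. simpl. rewrite IHn. reflexivity. Qed.

Lemma is_pseriesC_series (c : nat -> C) (z l : C) :
  is_pseriesC c z l <-> is_seriesC (fun n => z ^ n * c n)%C l.
Proof.
  unfold is_pseries. split; apply is_series_ext; intros n.
  - exact (f_equal (fun w => w * c n)%C (pow_n_Cpow z n)).
  - exact (f_equal (fun w => w * c n)%C (eq_sym (pow_n_Cpow z n))).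
Qed.

Definition Csum (x : nat -> C) (n : nat) : C := sum_n (G := C_AbelianMonoid) x n.

Lemma Csum_O (x : nat -> C) : Csum x 0 = x 0%nat.
Proof. exact (sum_O (G := C_AbelianMonoid) x). Qed.

Lemma Csum_S (x : nat -> C) (n : nat) : Csum x (S n) = (Csum x n + x (S n))%C.
Proof. exact (sum_Sn (G := C_AbelianMonoid) x n). Qed.

Lemma Csum_ext (x y : nat -> C) (n : nat) :
  (forall k, (k <= n)%nat -> x k = y k) -> Csum x n = Csum y n.
Proof. exact (sum_n_ext_loc (G := C_AbelianMonoid) x y n). Qed.

Lemma Csum_Re (x : nat -> C) (n : nat) :
  Re (Csum x n) = sum_n (fun k => Re (x k)) n.
Proof. induction n; [rewrite Csum_O, sum_O; reflexivity|]. rewrite Csum_S, sum_Sn, <- IHn. reflexivity. Qed.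

Lemma Csum_Im (x : nat -> C) (n : nat) :
  Im (Csum x n) = sum_n (fun k => Im (x k)) n.
Proof. induction n; [rewrite Csum_O, sum_O; reflexivity|]. rewrite Csum_S, sum_Sn, <- IHn. reflexivity. Qed.

Lemma is_seriesC_Re (x : nat -> C) (l : C) :
  is_seriesC x l -> is_series (fun n => Re (x n)) (Re l).
Proof.
  intros H. unfold is_series in *.
  eapply filterlim_ext; [intros n; apply Csum_Re|].
  apply filterlim_comp with (1 := H). destruct l. apply (continuous_fst (U := R_UniformSpace) (V := R_UniformSpace)).
Qed.

Lemma is_seriesC_Im (x : nat -> C) (l : C) :
  is_seriesC x l -> is_series (fun n => Im (x n)) (Im l).
Proof.
  intros H. unfold is_series in *.
  eapply filterlim_ext; [intros n; apply Csum_Im|].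
  apply filterlim_comp with (1 := H). destruct l. apply (continuous_snd (U := R_UniformSpace) (V := R_UniformSpace)).
Qed.

Lemma is_seriesC_pair (x : nat -> C) (l : C) :
  is_series (fun n => Re (x n)) (Re l) -> is_series (fun n => Im (x n)) (Im l) ->
  is_seriesC x l.
Proof.
  intros H1 H2. unfold is_series in *.
  apply filterlim_locally. intros eps.
  apply (filterlim_locally (F := eventually) _ (Re l)) with (eps := eps) in H1.
  apply (filterlim_locally (F := eventually) _ (Im l)) with (eps := eps) in H2.
  generalize (filter_and _ _ H1 H2). apply filter_imp. intros n [A B].
  rewrite <- Csum_Re in A. rewrite <- Csum_Im in B. split; assumption.
Qed.

(** The triangle inequality compares the partial sums beyond [M]; both sides then pass to the
    limit. *)
Lemma Cmod_series_tail (x : nat -> C) (y : nat -> R) (l : C) (L : R) (M : nat) :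
  is_seriesC x l -> is_series y L -> (forall n, Cmod (x n) <= y n) ->
  Cmod (l - Csum x M)%C <= L - sum_n y M.
Proof.
  intros Hx Hy Hle.
  assert (A : is_lim_seq (fun n => Cmod (Csum x n - Csum x M)%C)
       (Cmod (l - Csum x M)%C)).
  { apply (filterlim_comp _ _ _ (fun n => Csum x n - Csum x M)%C Cmod
       eventually (locally (T := C_UniformSpace) (l - Csum x M)%C)).
    - unfold Cminus. eapply (filterlim_comp_2 (F := eventually)); [apply Hx|apply filterlim_const|].
      apply (filterlim_plus (K := C_AbsRing) (V := C_NormedModule)).
    - apply (filterlim_norm (K := C_AbsRing) (V := C_NormedModule)). }
  assert (B : is_lim_seq (fun n => sum_n y n - sum_n y M) (L - sum_n y M)).
  { apply is_lim_seq_minus'; [exact Hy|apply is_lim_seq_const]. }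
  refine (is_lim_seq_le_loc _ _ (Finite _) (Finite _) _ A B).
  exists M. intros n Hn. induction Hn as [|n Hn IH].
  - replace (_ - _)%C with (RtoC 0) by ring. rewrite Cmod_0. lra.
  - rewrite Csum_S, sum_Sn. change plus with Rplus.
    replace (_ - _)%C with ((Csum x n - Csum x M) + x (S n))%C by ring.
    eapply Rle_trans; [apply Cmod_triangle|]. specialize (Hle (S n)). lra.
Qed.

(** Outside the circle of convergence the terms do not tend to [0], so convergence at [t] keeps
    [|t|] within the radius. *)
Lemma CV_radius_gt (u : nat -> R) (s t : R) :
  Rabs s < Rabs t -> ex_pseries u t -> Rbar_lt (Rabs s) (CV_radius u).
Proof.
  intros Hst [l Hl]. apply Rbar_lt_le_trans with (Rabs t); [exact Hst|].
  apply Rbar_not_lt_le. intros K. apply (CV_disk_outside u t K).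
  apply is_lim_seq_ext with (fun n => scal (pow_n t n) (u n)).
  - intros n. rewrite pow_n_pow. simpl. apply Rmult_comm.
  - apply ex_series_lim_0. exists l. exact Hl.
Qed.

(** * Restriction to rays and termwise differentiation *)

Lemma im_le_Cmod (c : C) : Rabs (Im c) <= Cmod c.
Proof. eapply Rle_trans; [apply Rmax_r|apply Rmax_Cmod]. Qed.

(** The chain rule for [s -> g (s z)] at [s = 1]. It turns the complex derivative into two real
    ones, to which the theory of real power series applies. *)
Lemma is_derive_along_ray (g : C -> C) (z l : C) :
  is_derive (K := C_AbsRing) (V := C_NormedModule) g z l ->
  is_derive (fun s : R => Re (g (s * z)%C)) 1 (Re (z * l)%C) /\
  is_derive (fun s : R => Im (g (s * z)%C)) 1 (Im (z * l)%C).
Proof.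
  intros [_ Hd]. specialize (Hd z (fun P HP => HP)).
  assert (HR : forall h : R, h <> 0 -> forall w : C,
     (Re w / h = Re (w / h)%C /\ Im w / h = Im (w / h)%C)).
  { intros h Hh w. destruct w; simpl. split; field; auto. }
  assert (Key : forall eps : R, 0 < eps -> exists delta : posreal, forall h : R, h <> 0 ->
     Rabs h < delta -> Cmod ((g ((1 + h)%R * z) - g (1 * z)) / h - z * l)%C < eps).
  { intros eps Heps.
    assert (Z := Cmod_ge_0 z).
    (* The increment [h z] brings in a factor [|z|], which [1 + |z|] absorbs, also for [z = 0]. *)
    assert (He : 0 < eps / (2 * (1 + Cmod z))) by (apply Rdiv_lt_0_compat; lra).
    destruct (Hd (mkposreal _ He)) as [delta Hdelta].
    assert (Hdl : 0 < delta / (1 + Cmod z)) by (apply Rdiv_lt_0_compat; [apply cond_pos|lra]).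
    exists (mkposreal _ Hdl). intros h Hh Hhd. simpl in Hhd.
    assert (Hh' : RtoC h <> 0) by (intros K; apply Hh, RtoC_inj; exact K).
    assert (Hb : Cmod (h * z)%C < delta).
    { rewrite Cmod_mult, Cmod_R.
      apply Rle_lt_trans with (Rabs h * (1 + Cmod z)).
      - apply Rmult_le_compat_l; [apply Rabs_pos|lra].
      - apply (Rmult_lt_compat_r (1 + Cmod z)) in Hhd; [|lra].
        field_simplify in Hhd; lra. }
    specialize (Hdelta ((1 + h)%R * z)%C).
    assert (E : ((1 + h)%R * z - z = h * z)%C) by (rewrite RtoC_plus; ring).
    assert (Hball : Cmod ((1 + h)%R * z - z)%C < delta) by (rewrite E; exact Hb).
    specialize (Hdelta Hball). simpl in Hdelta.
    change (Cmod ((g ((1 + h)%R * z) - g z) - ((1 + h)%R * z - z) * l)%C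
      <= eps / (2 * (1 + Cmod z)) * Cmod ((1 + h)%R * z - z)%C) in Hdelta.
    rewrite E in Hdelta. rewrite Cmult_1_l.
    replace (_ / _ - _)%C with ((g ((1 + h)%R * z) - g z - h * z * l) / h)%C by (field; auto).
    rewrite Cmod_div by auto. rewrite Cmod_mult, Cmod_R in *.
    assert (P := Rabs_pos_lt h Hh).
    apply (Rmult_lt_reg_r (Rabs h)); auto.
    replace (_ / Rabs h * Rabs h) with (Cmod (g ((1 + h)%R * z) - g z - h * z * l)%C) by (field; lra).
    eapply Rle_lt_trans; [exact Hdelta|].
    replace (eps / (2 * (1 + Cmod z)) * (Rabs h * Cmod z)) with
      (eps * Rabs h * (Cmod z / (2 * (1 + Cmod z)))) by (field; lra).
    assert (0 < eps * Rabs h) by (apply Rmult_lt_0_compat; auto).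
    assert (Cmod z / (2 * (1 + Cmod z)) < 1).
    { apply Rmult_lt_reg_r with (2 * (1 + Cmod z)); [lra|]. field_simplify; lra. }
    nra. }
  split; apply is_derive_Reals; intros eps Heps; destruct (Key eps Heps) as [delta H];
    exists delta; intros h Hh Hhd; specialize (H h Hh Hhd); eapply Rle_lt_trans; [|exact H| |exact H].
  - destruct (HR h Hh (g ((1 + h)%R * z) - g (1 * z))%C) as [A _].
    assert (B := re_le_Cmod ((g ((1 + h)%R * z) - g (1 * z)) / h - z * l)%C).
    unfold Cminus at 1 in B. rewrite re_plus, <- A in B. exact B.
  - destruct (HR h Hh (g ((1 + h)%R * z) - g (1 * z))%C) as [_ A].
    assert (B := im_le_Cmod ((g ((1 + h)%R * z) - g (1 * z)) / h - z * l)%C).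
    unfold Cminus at 1 in B. rewrite im_plus, <- A in B. exact B.
Qed.

Lemma disk_enlarge (z : C) (s : R) : disk (s * z)%C ->
  exists t : R, Rabs s < Rabs t /\ disk (t * z)%C.
Proof.
  unfold disk. rewrite Cmod_mult, Cmod_R. intros H.
  assert (Z := Cmod_ge_0 z). assert (S0 := Rabs_pos s).
  set (m := Rabs s) in *. set (k := Cmod z) in *.
  assert (D : 0 < (1 - m * k) / (1 + k)) by (apply Rdiv_lt_0_compat; lra).
  (* With the increment [D = (1 - m k) / (1 + k)], the new modulus [(m + D) k] equals [1 - D]. *)
  exists (m + (1 - m * k) / (1 + k)). rewrite Cmod_mult, Cmod_R.
  rewrite Rabs_pos_eq by lra. split; [lra|]. fold k.
  replace (_ * k) with (1 - (1 - m * k) / (1 + k)) by (field; lra). lra.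
Qed.

(** Termwise differentiation at [1], which lies strictly inside the circle of convergence. The
    derived series starts at index [1]; the term of index [0] is zero. *)
Lemma is_series_of_ray_derivative (u : nat -> R) (h : R -> R) (d : R) :
  Rbar_lt (Rabs 1) (CV_radius u) ->
  locally 1 (fun s => is_pseries u s (h s)) -> is_derive h 1 d ->
  is_series (fun n => INR n * u n) d.
Proof.
  intros Hr Hloc Hd.
  assert (E : PSeries (PS_derive u) 1 = d).
  { rewrite <- (Derive_PSeries u 1 Hr), <- (is_derive_unique _ _ _ Hd).
    apply Derive_ext_loc. revert Hloc. apply filter_imp. intros s. apply is_pseries_unique. }
  apply is_series_decr_1.
  replace (plus d _) with d by (change (d = d + - (0 * u 0%nat)); ring).
  assert (A := PSeries_correct _ _ (ex_pseries_derive _ _ Hr)). rewrite E in A.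
  revert A. apply is_series_ext. intros n. rewrite pow_n_pow, pow1. apply Rmult_1_l.
Qed.

Lemma ray_locally (z : C) : disk z -> locally 1 (fun s : R => disk (s * z)%C).
Proof.
  intros Hz.
  assert (Hc : filterlim (fun s : R => Rabs s * Cmod z) (locally 1) (locally (Rabs 1 * Cmod z))).
  { apply (continuous_mult (K := R_AbsRing) (fun s : R => Rabs s) (fun _ => Cmod z) 1).
    - apply continuous_Rabs.
    - apply continuous_const. }
  assert (L : Rabs 1 * Cmod z < 1) by (rewrite Rabs_R1, Rmult_1_l; exact Hz).
  assert (Hl := Hc (fun u => u < 1) (open_lt 1 _ L)). unfold filtermap in Hl.
  revert Hl. apply filter_imp. intros s Hs.
  unfold disk. rewrite Cmod_mult, Cmod_R. exact Hs.
Qed.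

Section DiskSeries.
Variables (c : nat -> C) (g : C -> C).
Hypothesis Hg : forall z : C, disk z -> is_pseriesC c z (g z).

(** As [s] is real, [(s z)^n c_n] has real part [s^n Re (z^n c_n)]: on each ray the real part is a
    real power series in [s]. *)
Lemma ray_Re (z : C) (s : R) : disk (s * z)%C ->
  is_pseries (fun n => Re (z ^ n * c n)%C) s (Re (g (s * z)%C)).
Proof.
  intros Hs. apply Hg, is_pseriesC_series, is_seriesC_Re in Hs.
  revert Hs. apply is_series_ext. intros n.
  rewrite pow_n_pow, Cpow_mult_l, <- RtoC_pow, <- Cmult_assoc.
  destruct (z ^ n * c n)%C. simpl. change scal with Rmult. change mult with Rmult. ring.
Qed.

Lemma ray_Im (z : C) (s : R) : disk (s * z)%C ->
  is_pseries (fun n => Im (z ^ n * c n)%C) s (Im (g (s * z)%C)).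
Proof.
  intros Hs. apply Hg, is_pseriesC_series, is_seriesC_Im in Hs.
  revert Hs. apply is_series_ext. intros n.
  rewrite pow_n_pow, Cpow_mult_l, <- RtoC_pow, <- Cmult_assoc.
  destruct (z ^ n * c n)%C. simpl. change scal with Rmult. change mult with Rmult. ring.
Qed.

Lemma ray_Re_radius (z : C) (s : R) : disk (s * z)%C ->
  Rbar_lt (Rabs s) (CV_radius (fun n => Re (z ^ n * c n)%C)).
Proof.
  intros Hs. destruct (disk_enlarge z s Hs) as [t [H1 H2]].
  apply CV_radius_gt with t; auto. eexists. apply ray_Re, H2.
Qed.

Lemma ray_Im_radius (z : C) (s : R) : disk (s * z)%C ->
  Rbar_lt (Rabs s) (CV_radius (fun n => Im (z ^ n * c n)%C)).
Proof.
  intros Hs. destruct (disk_enlarge z s Hs) as [t [H1 H2]].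
  apply CV_radius_gt with t; auto. eexists. apply ray_Im, H2.
Qed.

(** On the ray through [1] both components converge absolutely inside their radius, and
    [|c_n| <= |Re c_n| + |Im c_n|]. *)
Lemma pseries_abs_summable (r : R) : 0 <= r < 1 -> ex_series (fun n => Cmod (c n) * r ^ n).
Proof.
  intros Hr.
  assert (D : disk (r * 1)%C).
  { unfold disk. rewrite Cmult_1_r, Cmod_R, Rabs_pos_eq; lra. }
  assert (A := CV_disk_inside _ _ (ray_Re_radius _ _ D)).
  assert (B := CV_disk_inside _ _ (ray_Im_radius _ _ D)).
  refine (ex_series_le _ _ _ (ex_series_plus _ _ A B)).
  intros n. rewrite Cpow_1_l, Cmult_1_l.
  change norm with Rabs. change plus with Rplus.
  assert (0 <= r ^ n) by (apply pow_le; lra).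
  rewrite !Rabs_mult, (Rabs_pos_eq (Cmod _)), (Rabs_pos_eq (r ^ n)) by (auto using Cmod_ge_0).
  rewrite <- Rmult_plus_distr_r. apply Rmult_le_compat_r; auto.
  assert (G := Cmod_sq (c n)). assert (G0 := Cmod_ge_0 (c n)).
  assert (K1 := Rabs_pos (Re (c n))). assert (K2 := Rabs_pos (Im (c n))).
  assert (L1 := Rsqr_abs (Re (c n))). assert (L2 := Rsqr_abs (Im (c n))). unfold Rsqr in *.
  nra.
Qed.

(** Both components are differentiated along the ray through [z] at [s = 1]; the factor [z] in [z l]
    comes from the chain rule. *)
Lemma derivative_pseries (z l : C) : disk z ->
  is_derive (K := C_AbsRing) (V := C_NormedModule) g z l ->
  is_seriesC (fun n => INR n * (z ^ n * c n))%C (z * l)%C.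
Proof.
  intros Hz Hd.
  assert (D1 : disk (1 * z)%C) by (rewrite Cmult_1_l; exact Hz).
  destruct (is_derive_along_ray g z l Hd) as [DR DI].
  apply is_seriesC_pair.
  - apply is_series_ext with (fun n => INR n * Re (z ^ n * c n)%C).
    { intros n. destruct (z ^ n * c n)%C; simpl; ring. }
    refine (is_series_of_ray_derivative _ _ _ _ _ DR).
    + apply ray_Re_radius, D1.
    + generalize (ray_locally z Hz). apply filter_imp. intros s. apply ray_Re.
  - apply is_series_ext with (fun n => INR n * Im (z ^ n * c n)%C).
    { intros n. destruct (z ^ n * c n)%C; simpl; ring. }
    refine (is_series_of_ray_derivative _ _ _ _ _ DI).
    + apply ray_Im_radius, D1.
    + generalize (ray_locally z Hz). apply filter_imp. intros s. apply ray_Im.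
Qed.
End DiskSeries.

(** * Positivity of the Toeplitz form *)

Lemma Csum_plus (x y : nat -> C) (n : nat) :
  Csum (fun k => x k + y k)%C n = (Csum x n + Csum y n)%C.
Proof. apply (sum_n_plus (G := C_AbelianMonoid)). Qed.

Lemma Csum_mult_l (a : C) (x : nat -> C) (n : nat) :
  Csum (fun k => a * x k)%C n = (a * Csum x n)%C.
Proof. apply (sum_n_mult_l (K := C_Ring)). Qed.

Lemma Csum_switch (x : nat -> nat -> C) (m n : nat) :
  Csum (fun i => Csum (x i) n) m = Csum (fun j => Csum (fun i => x i j) m) n.
Proof. apply (sum_n_switch (G := C_AbelianMonoid)). Qed.

Lemma Csum_geometric (y : C) (n : nat) :
  ((1 - y) * Csum (fun j => y ^ j) n = 1 - y ^ S n)%C.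
Proof.
  induction n as [|n IH].
  - rewrite Csum_O. simpl. ring.
  - rewrite Csum_S, Cmult_plus_distr_l, IH.
    rewrite !Cpow_S. ring.
Qed.

Lemma Csum_const (y : C) (n : nat) : Csum (fun _ => y) n = (INR (S n) * y)%C.
Proof.
  induction n as [|n IH].
  - rewrite Csum_O. simpl. ring.
  - rewrite Csum_S, IH, (S_INR (S n)), RtoC_plus. ring.
Qed.

(** * Averages over roots of unity *)

Definition cis (x : R) : C := (cos x, sin x).

Lemma cis_plus (x y : R) : cis (x + y) = (cis x * cis y)%C.
Proof. unfold cis, Cmult. simpl. rewrite cos_plus, sin_plus. f_equal; ring. Qed.

Lemma cis_pow (x : R) (n : nat) : (cis x ^ n)%C = cis (INR n * x).
Proof.
  induction n as [|n IH].
  - simpl. rewrite Rmult_0_l. unfold cis. rewrite cos_0, sin_0. reflexivity.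
  - rewrite Cpow_S, IH, <- cis_plus, S_INR. f_equal. ring.
Qed.

Lemma cis_conj (x : R) : Cconj (cis x) = cis (- x).
Proof. unfold cis, Cconj. simpl. rewrite cos_neg, sin_neg. reflexivity. Qed.

Lemma Cmod_cis (x : R) : Cmod (cis x) = 1.
Proof.
  assert (A := Cmod_sq (cis x)). assert (B := Cmod_ge_0 (cis x)).
  assert (D := sin2_cos2 x). unfold Rsqr in D. unfold cis in *. simpl in A. nra.
Qed.

Lemma cis_neq_1 (x : R) : sin x <> 0 -> cis (2 * x) <> 1.
Proof.
  intros H E. apply (f_equal Re) in E. simpl in E. rewrite cos_2a_sin in E. nra.
Qed.

Section RootsOfUnity.
Variable n : nat.
(** The order is [n + 1], the number of terms in [Csum _ n]. *)
Let zeta : C := cis (2 * PI / INR (S n)).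

Lemma Cmod_root_pow (j : nat) : Cmod (zeta ^ j) = 1.
Proof. rewrite Cmod_pow. unfold zeta. rewrite Cmod_cis. apply pow1. Qed.

(** A geometric sum with ratio [cis (2 x)], whose power [n + 1] is [1]. For distinct exponents up to
    [n], [0 < |x| < PI], so the ratio is not [1] and the sum vanishes. *)
Lemma roots_of_unity_orthogonal (i l : nat) : (i <= n)%nat -> (l <= n)%nat ->
  Csum (fun j => (zeta ^ j) ^ i * Cconj (zeta ^ j) ^ l)%C n
  = if Nat.eqb i l then RtoC (INR (S n)) else 0.
Proof.
  intros Hi Hl.
  assert (N0 : 0 < INR (S n)) by (apply lt_0_INR; lia).
  set (x := (INR i - INR l) * (PI / INR (S n))).
  rewrite (Csum_ext _ (fun j => cis (2 * x) ^ j)%C).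
  2:{ intros j _. unfold zeta. rewrite !cis_pow, cis_conj, !cis_pow, <- cis_plus.
      f_equal. unfold x. field. lra. }
  destruct (Nat.eqb_spec i l) as [E|E].
  - rewrite (Csum_ext _ (fun _ => RtoC 1)).
    { rewrite Csum_const. ring. }
    intros j _. rewrite cis_pow. unfold x. rewrite E, Rminus_diag.
    replace (INR j * _) with 0 by ring. unfold cis. rewrite cos_0, sin_0. reflexivity.
  - assert (Hs : sin x <> 0).
    { assert (P := PI_RGT_0).
      assert (Bd : forall a b : nat, (a < b)%nat -> (b <= n)%nat ->
         0 < sin ((INR b - INR a) * (PI / INR (S n)))).
      { intros a b Hab Hb. apply lt_INR in Hab. apply le_INR in Hb.
        assert (A := pos_INR a). rewrite S_INR in *.
        assert (0 < PI / (INR n + 1)) by (apply Rdiv_lt_0_compat; lra).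
        apply sin_gt_0.
        - apply Rmult_lt_0_compat; lra.
        - apply Rlt_le_trans with ((INR n + 1) * (PI / (INR n + 1))).
          + apply Rmult_lt_compat_r; lra.
          + right. field. lra. }
      destruct (Nat.lt_total i l) as [K|[K|K]]; [|contradiction|].
      - specialize (Bd i l K Hl). unfold x.
        replace ((INR i - INR l) * _) with (- ((INR l - INR i) * (PI / INR (S n)))) by ring.
        rewrite sin_neg. lra.
      - specialize (Bd l i K Hi). unfold x. lra. }
    apply cis_neq_1 in Hs.
    assert (G := Csum_geometric (cis (2 * x)) n).
    assert (Y : (cis (2 * x) ^ S n)%C = 1).
    { rewrite cis_pow.
      replace (INR (S n) * (2 * x)) with (INR i * (2 * PI) + - (INR l * (2 * PI)))
        by (unfold x; field; lra).
      rewrite cis_plus, <- cis_conj, <- !cis_pow.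
      replace (cis (2 * PI)) with (RtoC 1) by (unfold cis; rewrite cos_2PI, sin_2PI; reflexivity).
      rewrite !Cpow_1_l. unfold Cconj. simpl. unfold Cmult; simpl.
      apply (f_equal2 pair); ring. }
    rewrite Y in G.
    assert (D : (1 - cis (2 * x))%C <> 0).
    { intros K. apply Hs. replace (cis (2 * x)) with (1 - (1 - cis (2 * x)))%C by ring.
      rewrite K. ring. }
    set (S0 := Csum _ n) in *.
    replace S0 with (((1 - cis (2 * x)) * S0) / (1 - cis (2 * x)))%C by (field; auto).
    rewrite G. field. auto.
Qed.

Variables q0 q1 q2 q3 : C.
Let q (u : C) : C := (q0 + q1 * u + q2 * u ^ 2 + q3 * u ^ 3)%C.
Let delta (i l : nat) : C := if Nat.eqb i l then RtoC 1 else RtoC 0.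

(** All exponents in [u^m |q|^2] stay at most [n], so there is no aliasing: a product [q_i conj q_l]
    survives only if [m + i = l]. *)
Lemma weighted_monomial_sum (m : nat) : (m + 3 <= n)%nat ->
  Csum (fun j => (zeta ^ j) ^ m * (q (zeta ^ j) * Cconj (q (zeta ^ j))))%C n
  = (INR (S n) *
     (delta m 0 * (q0 * Cconj q0 + q1 * Cconj q1 + q2 * Cconj q2 + q3 * Cconj q3)
      + delta m 1 * (q0 * Cconj q1 + q1 * Cconj q2 + q2 * Cconj q3)
      + delta m 2 * (q0 * Cconj q2 + q1 * Cconj q3) + delta m 3 * (q0 * Cconj q3)))%C.
Proof.
  intros Hm.
  set (e := fun (i l j : nat) => ((zeta ^ j) ^ i * Cconj (zeta ^ j) ^ l)%C).
  (* The sixteen products, ordered by [l - i]. The last six have [l < i] and vanish for every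
     [m]. *)
  rewrite (Csum_ext _ (fun j =>
     q0 * Cconj q0 * e m 0%nat j + (q1 * Cconj q1 * e (m + 1)%nat 1%nat j
   + (q2 * Cconj q2 * e (m + 2)%nat 2%nat j + (q3 * Cconj q3 * e (m + 3)%nat 3%nat j
   + (q0 * Cconj q1 * e m 1%nat j + (q1 * Cconj q2 * e (m + 1)%nat 2%nat j
   + (q2 * Cconj q3 * e (m + 2)%nat 3%nat j
   + (q0 * Cconj q2 * e m 2%nat j + (q1 * Cconj q3 * e (m + 1)%nat 3%nat j
   + (q0 * Cconj q3 * e m 3%nat j
   + (q1 * Cconj q0 * e (m + 1)%nat 0%nat j + (q2 * Cconj q1 * e (m + 2)%nat 1%nat j
   + (q3 * Cconj q2 * e (m + 3)%nat 2%nat j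
   + (q2 * Cconj q0 * e (m + 2)%nat 0%nat j + (q3 * Cconj q1 * e (m + 3)%nat 1%nat j
   + q3 * Cconj q0 * e (m + 3)%nat 0%nat j)))))))))))))))%C).
  2:{ intros j _. unfold e, q. rewrite !Cplus_conj, !Cmult_conj, !Cpow_conj, !Cpow_add_r.
      generalize ((zeta ^ j) ^ m)%C (zeta ^ j)%C (Cconj zeta ^ j)%C. intros; ring. }
  rewrite !Csum_plus, !Csum_mult_l. unfold e.
  rewrite !roots_of_unity_orthogonal by lia.
  unfold delta. destruct m as [|[|[|[|m]]]]; simpl Nat.eqb; cbv iota; try ring.
Qed.
End RootsOfUnity.

Lemma toeplitz4_trig_poly (b : nat -> C) (k : nat) (q0 q1 q2 q3 : C) :
  (forall u : C, Cmod u = 1 -> 0 <= Re (Csum (fun m => b m * u ^ m)%C (3 + k))) ->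
  0 <= Re (toeplitz4 (b 0%nat) (b 1%nat) (b 2%nat) (b 3%nat) q0 q1 q2 q3).
Proof.
  intros H.
  (* The degree [3 + k] of [P] plus the degree [3] of [q]. *)
  set (n := (3 + k + 3)%nat). set (zeta := cis (2 * PI / INR (S n))).
  set (q := fun u : C => (q0 + q1 * u + q2 * u ^ 2 + q3 * u ^ 3)%C).
  set (P := fun u : C => Csum (fun m => b m * u ^ m)%C (3 + k)).
  assert (S1 : Csum (fun j => P (zeta ^ j)%C * (q (zeta ^ j) * Cconj (q (zeta ^ j))))%C n
     = (INR (S n) * toeplitz4 (b 0%nat) (b 1%nat) (b 2%nat) (b 3%nat) q0 q1 q2 q3)%C).
  { rewrite (Csum_ext _ (fun j => Csum (fun m => b m *
       ((zeta ^ j) ^ m * (q (zeta ^ j) * Cconj (q (zeta ^ j)))))%C (3 + k))).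
    2:{ intros j _. unfold P. rewrite Cmult_comm, <- Csum_mult_l. apply Csum_ext. intros m _. ring. }
    rewrite Csum_switch.
    set (d := fun i l : nat => if Nat.eqb i l then RtoC 1 else RtoC 0).
    rewrite (Csum_ext _ (fun m => b m * (INR (S n) *
     (d m 0%nat * (q0 * Cconj q0 + q1 * Cconj q1 + q2 * Cconj q2 + q3 * Cconj q3)
      + d m 1%nat * (q0 * Cconj q1 + q1 * Cconj q2 + q2 * Cconj q3)
      + d m 2%nat * (q0 * Cconj q2 + q1 * Cconj q3) + d m 3%nat * (q0 * Cconj q3))))%C).
    2:{ intros m Hm. rewrite Csum_mult_l. f_equal.
        apply (weighted_monomial_sum n q0 q1 q2 q3 m). unfold n. lia. }
    (* Raising [k] only adds a monomial of degree above [3], whose contribution is zero. *)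
    clearbody n. clear. induction k as [|k IH].
    - simpl Nat.add. rewrite !Csum_S, Csum_O. unfold d, toeplitz4. simpl Nat.eqb. cbv iota. ring.
    - rewrite Nat.add_succ_r, Csum_S, IH. unfold d. simpl Nat.eqb. cbv iota. ring. }
  assert (S2 : 0 <= Re (Csum (fun j => P (zeta ^ j)%C * (q (zeta ^ j) * Cconj (q (zeta ^ j))))%C n)).
  { rewrite Csum_Re.
    assert (T : forall j, 0 <= Re (P (zeta ^ j)%C * (q (zeta ^ j) * Cconj (q (zeta ^ j))))%C).
    { intros j. rewrite <- Cmod2_conj, re_scal_r.
      apply Rmult_le_pos; [|apply pow2_ge_0]. apply H, Cmod_root_pow. }
    generalize n at 1. intros n0. induction n0 as [|n0 IH].
    - rewrite sum_O. apply T.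
    - rewrite sum_Sn. apply Rplus_le_le_0_compat; auto. }
  rewrite S1, re_scal_l in S2.
  assert (0 < INR (S n)) by (apply lt_0_INR; lia). nra.
Qed.

(** The limit [h -> 0] by an explicit choice: the expression exceeds [t0 + t1 + t2 + t3] by at most
    [h K]. If that sum were [- d < 0], an [h] with [h K <= d / 2] would make the expression
    negative. *)
Lemma cubic_nonneg_limit (A t0 t1 t2 t3 : R) :
  (forall h : R, 0 < h < 1 -> 0 <= t0 + h * A + t1 * (1 - h) + t2 * (1 - h) ^ 2 + t3 * (1 - h) ^ 3) ->
  0 <= t0 + t1 + t2 + t3.
Proof.
  intros H. apply Rnot_lt_le. intros Hlt.
  set (K := 1 + Rabs A + Rabs t1 + 2 * Rabs t2 + 3 * Rabs t3).
  assert (P := Rabs_pos A). assert (P1 := Rabs_pos t1).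
  assert (P2 := Rabs_pos t2). assert (P3 := Rabs_pos t3).
  assert (K1 : 1 <= K) by (unfold K; lra).
  set (d := - (t0 + t1 + t2 + t3)) in *.
  assert (Hd : 0 < d) by (unfold d; lra).
  set (h := Rmin (1/2) (d / (2 * K))).
  assert (Q : 0 < d / (2 * K)) by (apply Rdiv_lt_0_compat; lra).
  assert (h0 : 0 < h) by (unfold h; apply Rmin_pos; lra).
  assert (h1 : h <= 1/2) by apply Rmin_l.
  assert (h2 : h * K <= d / 2).
  { apply Rle_trans with (d / (2 * K) * K); [apply Rmult_le_compat_r; [lra|apply Rmin_r]|].
    right; field; lra. }
  assert (h01 : 0 < h < 1) by lra. specialize (H h h01).
  assert (G : A - t1 + t2 * (h - 2) + t3 * (3 * h - 3 - h * h) <= K).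
  { assert (E0 := Rle_abs A). assert (E1 := Rle_abs (- t1)). assert (E2 := Rle_abs (- t2)).
    assert (E3 := Rle_abs (- t3)). rewrite Rabs_Ropp in *. unfold K.
    assert (0 <= h * h <= h) by (split; nra).
    assert (- t2 * (2 - h) <= Rabs t2 * 2).
    { apply Rle_trans with (Rabs t2 * (2 - h)).
      - apply Rmult_le_compat_r; lra.
      - apply Rmult_le_compat_l; lra. }
    assert (- t3 * (3 - 3 * h + h * h) <= Rabs t3 * 3).
    { apply Rle_trans with (Rabs t3 * (3 - 3 * h + h * h)).
      - apply Rmult_le_compat_r; lra.
      - apply Rmult_le_compat_l; lra. }
    lra. }
  assert (h * (A - t1 + t2 * (h - 2) + t3 * (3 * h - 3 - h * h)) <= h * K)
    by (apply Rmult_le_compat_l; lra).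
  unfold d in *. nra.
Qed.

(** On the circle of radius [1 - h], [p] is truncated where the tail is at most [h], and [h] is
    added to the constant term. This trigonometric polynomial has nonnegative real part, and
    [h -> 0] recovers the form of [c]. *)
Lemma toeplitz4_caratheodory (c : nat -> C) (p : C -> C) (q0 q1 q2 q3 : C) :
  (forall z : C, disk z -> is_pseriesC c z (p z)) ->
  (forall z : C, disk z -> z <> 0 -> 0 <= Re (p z)) ->
  0 <= Re (toeplitz4 (c 0%nat) (c 1%nat) (c 2%nat) (c 3%nat) q0 q1 q2 q3).
Proof.
  intros Hp Hpos.
  assert (H : forall h : R, 0 < h < 1 ->
    0 <= Re (toeplitz4 (c 0%nat + h) (c 1%nat * (1 - h)%R) (c 2%nat * (1 - h)%R ^ 2)
       (c 3%nat * (1 - h)%R ^ 3) q0 q1 q2 q3)%C).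
  { intros h Hh. set (r := 1 - h).
    assert (Hr : 0 < r < 1) by (unfold r; lra).
    destruct (pseries_abs_summable c p Hp r) as [Y HY]; [lra|].
    assert (HM : exists k, Y - sum_n (fun n => Cmod (c n) * r ^ n) (3 + k) <= h).
    { assert (Hl : is_lim_seq (sum_n (fun n => Cmod (c n) * r ^ n)) Y) by exact HY.
      apply is_lim_seq_spec in Hl. simpl in Hl.
      destruct (Hl (mkposreal h (proj1 Hh))) as [N HN]. exists N.
      specialize (HN (3 + N)%nat ltac:(lia)). cbn [pos] in HN.
      apply Rabs_lt_between in HN. lra. }
    destruct HM as [k Hk].
    (* The [h] in the constant term pays for the truncation error. *)
    set (b := fun m : nat => (c m * r ^ m + match m with O => RtoC h | _ => 0 end)%C).
    assert (T := toeplitz4_trig_poly b k q0 q1 q2 q3).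
    replace (c 0%nat + h)%C with (b 0%nat) by (unfold b; simpl; ring).
    replace (c 1%nat * r)%C with (b 1%nat) by (unfold b; simpl; ring).
    replace (c 2%nat * r ^ 2)%C with (b 2%nat) by (unfold b; simpl; ring).
    replace (c 3%nat * r ^ 3)%C with (b 3%nat) by (unfold b; simpl; ring).
    apply T. intros u Hu.
    assert (Hz : Cmod (r * u)%C = r) by (rewrite Cmod_mult, Hu, Cmod_R, Rabs_pos_eq; lra).
    assert (E : forall M, Csum (fun m => b m * u ^ m)%C M
       = (Csum (fun m => (r * u) ^ m * c m) M + h)%C).
    { induction M as [|M IH].
      - rewrite !Csum_O. unfold b. simpl. ring.
      - rewrite !Csum_S, IH. unfold b. rewrite Cpow_mult_l. ring. }
    rewrite E, re_plus. simpl (Re h).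
    assert (Hd : disk (r * u)%C) by (unfold disk; lra).
    assert (Hs := Hp _ Hd). apply is_pseriesC_series in Hs.
    assert (Tl := Cmod_series_tail _ _ _ _ (3 + k) Hs HY).
    assert (B : Cmod (p (r * u) - Csum (fun m => (r * u) ^ m * c m) (3 + k))%C <= h).
    { eapply Rle_trans; [apply Tl|exact Hk]. intros n.
      rewrite Cmod_mult, Cmod_pow, Hz. lra. }
    assert (P : 0 <= Re (p (r * u)%C)).
    { apply Hpos; auto. intros K. rewrite K, Cmod_0 in Hz. lra. }
    assert (Q := re_le_Cmod (p (r * u) - Csum (fun m => (r * u) ^ m * c m) (3 + k))%C).
    apply Rabs_le_between in Q. unfold Cminus in Q, B.
    rewrite re_plus in Q. change (Re (- ?w)%C) with (- Re w) in Q.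
    lra. }
  set (S0 := (q0 * Cconj q0 + q1 * Cconj q1 + q2 * Cconj q2 + q3 * Cconj q3)%C).
  (* The form is cubic in [1 - h], apart from [h Re S0], which the raised constant term
     contributes. *)
  assert (G := cubic_nonneg_limit (Re S0) (Re (c 0%nat * S0)%C)
    (Re (c 1%nat * (q0 * Cconj q1 + q1 * Cconj q2 + q2 * Cconj q3))%C)
    (Re (c 2%nat * (q0 * Cconj q2 + q1 * Cconj q3))%C) (Re (c 3%nat * (q0 * Cconj q3))%C)).
  unfold toeplitz4. rewrite !re_plus. apply G. intros h Hh.
  specialize (H h Hh).
  replace (_ + _) with (Re (toeplitz4 (c 0%nat + h) (c 1%nat * (1 - h)%R) (c 2%nat * (1 - h)%R ^ 2)
       (c 3%nat * (1 - h)%R ^ 3) q0 q1 q2 q3)%C); auto.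
  unfold toeplitz4. fold S0. rewrite <- !RtoC_pow.
  rewrite !re_plus. rewrite Cmult_plus_distr_r, re_plus, re_scal_l.
  rewrite <- !Cmult_assoc, !(Cmult_comm (RtoC _)), !Cmult_assoc, !re_scal_r. ring.
Qed.

(** * Logarithmic coefficients *)

Lemma pseries_coeff_unique (a b : nat -> R) (h : R -> R) :
  (forall s, Rabs s < 1 -> is_pseries a s (h s)) ->
  (forall s, Rabs s < 1 -> is_pseries b s (h s)) ->
  forall n, a n = b n.
Proof.
  intros Ha Hb n.
  assert (Hh : Rabs (1/2) < 1) by (rewrite Rabs_pos_eq; lra).
  assert (H0 : Rabs 0 < Rabs (1/2)) by (rewrite Rabs_R0, Rabs_pos_eq; lra).
  apply PSeries_ext_recip.
  - rewrite <- Rabs_R0. apply CV_radius_gt with (1/2); auto. eexists; apply Ha; auto.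
  - rewrite <- Rabs_R0. apply CV_radius_gt with (1/2); auto. eexists; apply Hb; auto.
  - exists (mkposreal 1 Rlt_0_1). intros s Hs.
    change (Rabs (s - 0) < 1) in Hs. rewrite Rminus_0_r in Hs.
    rewrite (is_pseries_unique _ _ _ (Ha s Hs)). symmetry. apply is_pseries_unique, Hb, Hs.
Qed.

(** Coefficient of [s^(n+1)] in one component of [z f' = f + z L' f]. The real part is the case
    [w = u] with [- B] for [B]; the imaginary part exchanges [u] and [v]. *)
Lemma log_derivative_coeff (u v w A B : nat -> R) :
  (forall x, List.In x (u :: v :: w :: A :: B :: nil)%list ->
     forall s, Rabs s < 1 -> Rbar_lt (Rabs s) (CV_radius x)) ->
  (forall s, Rabs s < 1 -> s * PSeries (PS_derive w) s = PSeries w s +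
     s * (PSeries (PS_derive A) s * PSeries u s + PSeries (PS_derive B) s * PSeries v s)) ->
  forall n, INR (S n) * w (S n) =
    w (S n) + (PS_mult (PS_derive A) u n + PS_mult (PS_derive B) v n).
Proof.
  intros Hr Hid n.
  assert (K : forall x, List.In x (u :: v :: w :: A :: B :: nil)%list ->
     forall s, Rabs s < 1 -> is_pseries x s (PSeries x s)).
  { intros x Hx s Hs. apply PSeries_correct, CV_radius_inside, Hr; auto. }
  assert (K' : forall x, List.In x (u :: v :: w :: A :: B :: nil)%list ->
     forall s, Rabs s < 1 -> is_pseries (PS_derive x) s (PSeries (PS_derive x) s)).
  { intros x Hx s Hs. apply PSeries_correct, CV_radius_inside. rewrite CV_radius_derive. apply Hr; auto. }
  refine (pseries_coeff_unique (PS_incr_1 (PS_derive w))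
    (PS_plus w (PS_incr_1 (PS_plus (PS_mult (PS_derive A) u) (PS_mult (PS_derive B) v))))
    (fun s => s * PSeries (PS_derive w) s) _ _ (S n)); intros s Hs.
  - apply (is_pseries_incr_1 _ s (PSeries (PS_derive w) s)). apply K'; simpl; auto.
  - rewrite Hid by auto.
    apply (is_pseries_plus (V := R_NormedModule) w _ s (PSeries w s)
      (s * (PSeries (PS_derive A) s * PSeries u s + PSeries (PS_derive B) s * PSeries v s))).
    + apply K; simpl; auto.
    + apply (is_pseries_incr_1 _ s (PSeries (PS_derive A) s * PSeries u s
        + PSeries (PS_derive B) s * PSeries v s)).
        apply (is_pseries_plus (V := R_NormedModule) _ _ s (PSeries (PS_derive A) s * PSeries u s)
          (PSeries (PS_derive B) s * PSeries v s));

        apply is_pseries_mult; rewrite ?CV_radius_derive.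
      * apply (K' A); simpl; auto.
      * apply (K u); simpl; auto.
      * apply (Hr A); simpl; auto.
      * apply (Hr u); simpl; auto.
      * apply (K' B); simpl; auto 6.
      * apply (K v); simpl; auto.
      * apply (Hr B); simpl; auto 6.
      * apply (Hr v); simpl; auto.
Qed.

(* Differentiating [f z = z * exp (L z)] along the real axis gives [z f' = f + z L' f]. *)
Lemma log_branch_coefficients (f L : C -> C) (c e : nat -> C) :
  (forall z, disk z -> is_pseriesC c z (f z)) ->
  (forall z, disk z -> is_pseriesC e z (L z)) ->
  (forall z, disk z -> z <> 0 -> Cexp (L z) = (f z / z)%C) ->
  c 0%nat = 0 -> c 1%nat = 1 ->
  (c 2%nat = e 1%nat /\
   2 * c 3%nat = 2 * e 2%nat + e 1%nat * c 2%nat /\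
   3 * c 4%nat = 3 * e 3%nat + 2 * e 2%nat * c 2%nat + e 1%nat * c 3%nat)%C.
Proof.
  intros Hf HL Hexp c0 c1.
  set (u := fun n => Re (1 ^ n * c n)%C). set (v := fun n => Im (1 ^ n * c n)%C).
  set (A := fun n => Re (1 ^ n * e n)%C). set (B := fun n => Im (1 ^ n * e n)%C).
  assert (D : forall s : R, Rabs s < 1 -> disk (s * 1)%C).
  { intros s Hs. unfold disk. rewrite Cmult_1_r, Cmod_R. exact Hs. }
  assert (Ru : forall s, Rabs s < 1 -> Rbar_lt (Rabs s) (CV_radius u)).
  { intros s Hs. apply (ray_Re_radius c f Hf), D, Hs. }
  assert (Rv : forall s, Rabs s < 1 -> Rbar_lt (Rabs s) (CV_radius v)).
  { intros s Hs. apply (ray_Im_radius c f Hf), D, Hs. }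
  assert (RA : forall s, Rabs s < 1 -> Rbar_lt (Rabs s) (CV_radius A)).
  { intros s Hs. apply (ray_Re_radius e L HL), D, Hs. }
  assert (RB : forall s, Rabs s < 1 -> Rbar_lt (Rabs s) (CV_radius B)).
  { intros s Hs. apply (ray_Im_radius e L HL), D, Hs. }
  (* The components of [f = s exp L] at real [s]; at [s = 0] both sides vanish because [c 0 = 0]. *)
  assert (Euv : forall s, Rabs s < 1 ->
     PSeries u s = s * (exp (PSeries A s) * cos (PSeries B s)) /\
     PSeries v s = s * (exp (PSeries A s) * sin (PSeries B s))).
  { intros s Hs.
    destruct (Req_dec s 0) as [E|E].
    - rewrite E, !Rmult_0_l, !PSeries_0. unfold u, v. rewrite c0, Cmult_0_r. split; reflexivity.
    - rewrite (is_pseries_unique u s _ (ray_Re c f Hf 1 s (D s Hs))).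
      rewrite (is_pseries_unique v s _ (ray_Im c f Hf 1 s (D s Hs))).
      rewrite (is_pseries_unique A s _ (ray_Re e L HL 1 s (D s Hs))).
      rewrite (is_pseries_unique B s _ (ray_Im e L HL 1 s (D s Hs))).
      assert (N : (s * 1)%C <> 0).
      { rewrite Cmult_1_r. intros K. apply E, RtoC_inj, K. }
      assert (X := Hexp _ (D s Hs) N). set (z := (s * 1)%C) in *.
      assert (Y : f z = (s * Cexp (L z))%C).
      { rewrite X. unfold z in *. rewrite Cmult_1_r in *. field. exact N. }
      rewrite Y. unfold Cexp. simpl. split; ring. }
  assert (Hloc : forall s, Rabs s < 1 -> locally s (fun t => Rabs t < 1)).
  { intros s Hs. exact (continuous_Rabs s _ (open_lt 1 _ Hs)). }
  assert (dA : forall s, Rabs s < 1 -> is_derive (PSeries A) s (PSeries (PS_derive A) s)).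
  { intros s Hs. apply is_derive_PSeries, RA, Hs. }
  assert (dB : forall s, Rabs s < 1 -> is_derive (PSeries B) s (PSeries (PS_derive B) s)).
  { intros s Hs. apply is_derive_PSeries, RB, Hs. }
  assert (dU : forall s, Rabs s < 1 -> s * PSeries (PS_derive u) s = PSeries u s +
     s * (PSeries (PS_derive A) s * PSeries u s
          + PSeries (PS_derive (PS_opp B)) s * PSeries v s)).
  { intros s Hs.
    assert (dO : PSeries (PS_derive (PS_opp B)) s = - PSeries (PS_derive B) s).
    { rewrite <- PSeries_opp. apply PSeries_ext. intros n. unfold PS_derive, PS_opp.
      change opp with Ropp. ring. }
    rewrite dO, <- (Derive_PSeries u s (Ru s Hs)).
    rewrite (Derive_ext_loc (PSeries u) (fun s => s * (exp (PSeries A s) * cos (PSeries B s)))).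
    2:{ generalize (Hloc s Hs). apply filter_imp. intros t Ht. apply Euv, Ht. }
    destruct (Euv s Hs) as [-> ->].
    rewrite (is_derive_unique _ s (exp (PSeries A s) * cos (PSeries B s) +
       s * (PSeries (PS_derive A) s * exp (PSeries A s) * cos (PSeries B s)
          - exp (PSeries A s) * (PSeries (PS_derive B) s * sin (PSeries B s))))).
    - ring.
    - specialize (dA s Hs). specialize (dB s Hs).
      auto_derive; [repeat split; eexists; eassumption|].
      rewrite (is_derive_unique (fun t : R => PSeries A t) _ _ dA),
        (is_derive_unique (fun t : R => PSeries B t) _ _ dB). ring. }
  assert (dV : forall s, Rabs s < 1 -> s * PSeries (PS_derive v) s = PSeries v s +
     s * (PSeries (PS_derive A) s * PSeries v s + PSeries (PS_derive B) s * PSeries u s)).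
  { intros s Hs.
    rewrite <- (Derive_PSeries v s (Rv s Hs)).
    rewrite (Derive_ext_loc (PSeries v) (fun s => s * (exp (PSeries A s) * sin (PSeries B s)))).
    2:{ generalize (Hloc s Hs). apply filter_imp. intros t Ht. apply Euv, Ht. }
    destruct (Euv s Hs) as [-> ->].
    rewrite (is_derive_unique _ s (exp (PSeries A s) * sin (PSeries B s) +
       s * (PSeries (PS_derive A) s * exp (PSeries A s) * sin (PSeries B s)
          + exp (PSeries A s) * (PSeries (PS_derive B) s * cos (PSeries B s))))).
    - ring.
    - specialize (dA s Hs). specialize (dB s Hs).
      auto_derive; [repeat split; eexists; eassumption|].
      rewrite (is_derive_unique (fun t : R => PSeries A t) _ _ dA),
        (is_derive_unique (fun t : R => PSeries B t) _ _ dB). ring. }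
  assert (RO : forall s, Rabs s < 1 -> Rbar_lt (Rabs s) (CV_radius (PS_opp B))).
  { intros s Hs. rewrite CV_radius_opp. apply RB, Hs. }
  assert (IU := log_derivative_coeff u v u A (PS_opp B)).
  assert (IV := log_derivative_coeff v u v A B).
  specialize (IU ltac:(intros x [<-|[<-|[<-|[<-|[<-|[]]]]]]; assumption) dU).
  specialize (IV ltac:(intros x [<-|[<-|[<-|[<-|[<-|[]]]]]]; assumption) dV).
  assert (Hc : forall n, c n = (u n, v n)).
  { intros n. unfold u, v. rewrite Cpow_1_l, Cmult_1_l. destruct (c n); reflexivity. }
  assert (He : forall n, e n = (A n, B n)).
  { intros n. unfold A, B. rewrite Cpow_1_l, Cmult_1_l. destruct (e n); reflexivity. }
  rewrite Hc in c0, c1. injection c0 as u0 v0. injection c1 as u1 v1.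
  rewrite !Hc, !He. clearbody u v A B.
  (* Indices [1], [2], [3] stand for orders [2], [3], [4]: [n c_(n+1)] is the sum of
     [k e_k c_(n+1-k)] over [k] from [1] to [n]. *)
  assert (U1 := IU 1%nat). assert (U2 := IU 2%nat). assert (U3 := IU 3%nat).
  assert (V1 := IV 1%nat). assert (V2 := IV 2%nat). assert (V3 := IV 3%nat).
  unfold PS_mult, PS_derive, PS_opp in *. change opp with Ropp in *. simpl in *.
  rewrite u0, v0, u1, v1 in *.
  repeat split; apply (f_equal2 pair); simpl; lra.
Qed.

(** Away from [0], [(1 - z) f' = (z f') / z - z f'], and the series of [z f'] is known; dividing by
    [z] shifts its index by one. *)
Lemma one_minus_z_derivative_pseries (f : C -> C) (c : nat -> C) :
  holomorphic_on_disk f -> (forall z, disk z -> is_pseriesC c z (f z)) ->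
  forall z, disk z -> z <> 0 ->
  is_pseriesC (fun n => INR (S n) * c (S n) - INR n * c n)%C z ((1 - z) * C_derive f z)%C.
Proof.
  intros Hh Hf z Hz Hz0. apply is_pseriesC_series.
  assert (Hd := C_derive_correct f z z (Hh z Hz)).
  assert (S1 := derivative_pseries c f Hf z _ Hz Hd).
  set (l := C_derive f z) in *.
  assert (S2 : is_seriesC (fun n => INR (S n) * (z ^ S n * c (S n)))%C (z * l)%C).
  { apply (is_series_incr_1 (K := C_AbsRing) (V := C_NormedModule)
      (fun n => INR n * (z ^ n * c n))%C).
    replace (plus _ _) with (z * l)%C; [exact S1|].
    change (z * l = z * l + 0 * (1 * c 0%nat))%C. ring. }
  apply (is_series_scal (K := C_AbsRing) (V := C_NormedModule) (/ z)%C) in S2.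
  assert (S3 := is_series_minus (K := C_AbsRing) (V := C_NormedModule) _ _ _ _ S2 S1).
  replace ((1 - z) * l)%C with (/ z * (z * l) - z * l)%C by (field; exact Hz0).
  revert S3. apply is_series_ext. intros n.
  change (/ z * (INR (S n) * (z ^ S n * c (S n))) - INR n * (z ^ n * c n)
    = z ^ n * (INR (S n) * c (S n) - INR n * c n))%C.
  rewrite Cpow_S. field. exact Hz0.
Qed.

Theorem theorem2p1 (f : C -> C) (gamma : nat -> C)
  (hf : class_F1 f) (hgamma : log_coefficients f gamma) :
  Cmod (gamma 3%nat) <= 15.75 / 48 /\ 15.75 / 48 = 0.328125.
Proof.
  split; [|lra].
  destruct hf as [[[Hh [a [a1 Ha]]] _] Hpos].
  destruct hgamma as [L [[_ [_ HL]] He]].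
  set (c := fun n => match n with O => RtoC 0 | S _ => a n end).
  set (e := fun n => match n with O => RtoC 0 | S _ => (2 * gamma n)%C end).
  destruct (log_branch_coefficients f L c e Ha He HL eq_refl a1) as [L1 [L2 L3]].
  set (b := fun n => (INR (S n) * c (S n) - INR n * c n)%C).
  (* The expansion of [(1 - z) f'] is available for [z <> 0]; at [0], [p] is given the constant term
     [1] of the series. *)
  set (p := fun z : C => if Req_EM_T (Cmod z) 0 then RtoC 1 else ((1 - z) * C_derive f z)%C).
  assert (b0 : b 0%nat = 1) by (unfold b, c; rewrite a1; simpl; ring).
  assert (Hp : forall z, disk z -> is_pseriesC b z (p z)).
  { intros z Hz. unfold p. destruct (Req_EM_T (Cmod z) 0) as [E|E].
    - apply Cmod_eq_0 in E. rewrite E, <- b0. apply (is_pseries_0 (K := C_AbsRing) (V := C_NormedModule)).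
    - apply one_minus_z_derivative_pseries; auto. intros K. apply E. rewrite K. apply Cmod_0. }
  assert (Hp0 : forall z, disk z -> z <> 0 -> 0 <= Re (p z)).
  { intros z Hz Hz0. unfold p. destruct (Req_EM_T (Cmod z) 0) as [E|E].
    - simpl. lra.
    - left. apply Hpos, Hz. }
  assert (two : RtoC 2 <> 0) by (intros K; apply RtoC_inj in K; lra).
  destruct (toeplitz4_schur (b 1%nat / 2) (b 2%nat / 2) (b 3%nat / 2))%C
    as [x [y [Ht [Hx [Hy [E2 E3]]]]]].
  { intros q0 q1 q2 q3. assert (T := toeplitz4_caratheodory b p q0 q1 q2 q3 Hp Hp0).
    rewrite b0 in T.
    replace (2 * (b 1%nat / 2))%C with (b 1%nat) by (field; auto).
    replace (2 * (b 2%nat / 2))%C with (b 2%nat) by (field; auto).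
    replace (2 * (b 3%nat / 2))%C with (b 3%nat) by (field; auto).
    exact T. }
  set (t := (b 1%nat / 2)%C) in *. set (s := 1 - Cmod t * Cmod t) in *.
  assert (B := logarithmic_functional_bound t x y Ht Hx Hy). fold s in B.
  replace (3 + _ + _ + _ - _ + _)%C with (48 * gamma 3%nat)%C in B.
  - rewrite Cmod_mult, Cmod_R, Rabs_pos_eq in B by lra. lra.
  - unfold c, e in *. cbv beta iota in *.
    (* [a 2], [a 3], [a 4] come from [2 d_n = (n + 1) a_(n+1) - n a_n]; the relations [L1], [L2],
       [L3] then give the [gamma n]. *)
    assert (A2 : a 2%nat = ((1 + 2 * t) / 2)%C).
    { unfold t, b. rewrite a1. simpl INR. rewrite RtoC_plus. field; auto. }
    assert (A3 : a 3%nat = ((2 * (t * t + s * x) + 2 * a 2%nat) / 3)%C).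
    { rewrite <- E2. unfold b. simpl INR. rewrite !RtoC_plus. field; auto. }
    assert (A4 : a 4%nat = ((2 * (t * t * t + 2 * t * (s * x) - Cconj t * (s * x) * x + y)
       + 3 * a 3%nat) / 4)%C).
    { rewrite <- E3. unfold b. simpl INR. rewrite !RtoC_plus. field; auto. }
    assert (G1 : gamma 1%nat = (a 2%nat / 2)%C) by (rewrite L1; field; auto).
    assert (G2 : gamma 2%nat = ((2 * a 3%nat - 2 * gamma 1%nat * a 2%nat) / 4)%C)
      by (rewrite L2; field; auto).
    assert (G3 : gamma 3%nat = ((3 * a 4%nat - 4 * gamma 2%nat * a 2%nat
       - 2 * gamma 1%nat * a 3%nat) / 6)%C) by (rewrite L3; field; auto).
    rewrite G3, G2, G1, A4, A3, A2.
    (* Writing [s] through [t] and [conj t] makes the remaining identity rational in [t], [conj t],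
       [x] and [y]. *)
    assert (Hs : RtoC s = (1 - t * Cconj t)%C).
    { unfold s. rewrite RtoC_minus, RtoC_mult, <- Cmod2_conj, RtoC_pow. ring. }
    rewrite Hs. field; auto.
Qed.
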